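(* Let $\mathbb{C}$ be a regular category and let $X$ be an object of $\mathbb{C}$ with global support, such that $X$ admits pushouts of any two of its product projections. Then $X$ has the finite strict refinement property if and only if $X$ is projection-coextensive.
   Context: A category is regular if it has finite limits, coequalizers of kernel pairs, and regular epimorphisms are stable under pullback. An object $X$ of a regular category has global support if $X\to 1$ is a regular epimorphism. A product projection of $X$ is a morphism $X\to A$ that is one of the two legs of some binary product diagram $A\leftarrow X\to A'$. $X$ has the finite strict refinement property if for any two finite product diagrams $(f_i:X\to A_i)_{i\in I}$ and $(g_j:X\to B_j)_{j\in J}$ there exist families of morphisms $(\alpha_{i,j}:A_i\to C_{i,j})_{i\in I,j\in J}$ and $(\beta_{i,j}:B_j\to C_{i,j})_{i\in I,j\in J}$ such that $\alpha_{i,j}f_i=\beta_{i,j}g_j$ for all $i,j$, and for every $i\in I$ and $j\in J$ the families $(\alpha_{i,s}:A_i\to C_{i,s})_{s\in J}$ and $(\beta_{t,j}:B_j\to C_{t,j})_{t\in I}$ are product diagrams. For a class $\mathcal{M}$ of morphisms, an $\mathcal{M}$-pushout is a pushout square whose two morphisms into the pushout object belong to $\mathcal{M}$. An object $X$ is $\mathcal{M}$-coextensive if every morphism in $\mathcal{M}$ with domain $X$ admits an $\mathcal{M}$-pushout along every product projection of $X$, and for every commutative diagram consisting of a product diagram $A_1\leftarrow X\to A_2$ (top row), a bottom row $B_1\leftarrow Y\to B_2$, and vertical morphisms $A_1\to B_1$, $X\to Y$, $A_2\to B_2$ all in $\mathcal{M}$, the bottom row is a product diagram if and only if both squares are $\mathcal{M}$-pushouts.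 $X$ is projection-coextensive if it is $\mathcal{M}$-coextensive with $\mathcal{M}$ the class of all product projections in $\mathbb{C}$. *)

(* Defs.v *)
From mathcomp Require Import all_boot.
From mathcomp Require Import classical_sets cardinality.

Set Implicit Arguments.
Unset Strict Implicit.
Unset Printing Implicit Defensive.

Declare Scope cat_scope.
Delimit Scope cat_scope with cat.

Reserved Notation "X ~> Y" (at level 70, no associativity).
Reserved Notation "g ∘ f" (at level 40, left associativity).

Record category : Type := Category {
  obj :> Type;
  hom : obj -> obj -> Type;
  idm : forall X, hom X X;
  compm : forall X Y Z, hom Y Z -> hom X Y -> hom X Z;
  comp1m : forall X Y (f : hom X Y), compm (idm Y) f = f;
  compm1 : forall X Y (f : hom X Y), compm f (idm X) = f;
  compmA : forall X Y Z W (h : hom Z W) (g : hom Y Z) (f : hom X Y),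
    compm h (compm g f) = compm (compm h g) f
}.

Notation "X ~> Y" := (hom X Y) : cat_scope.
Notation "g ∘ f" := (compm g f) : cat_scope.
Local Open Scope cat_scope.

Record functor (J C : category) : Type := Functor {
  fobj :> J -> C;
  fmap : forall a b : J, (a ~> b) -> (fobj a ~> fobj b);
  fmap1 : forall a : J, fmap (idm a) = idm (fobj a);
  fmapM : forall (a b c : J) (v : b ~> c) (u : a ~> b),
    fmap (v ∘ u) = fmap v ∘ fmap u
}.

Definition is_cone (J C : category) (F : functor J C)
    (L : C) (p : forall j : J, L ~> F j) : Prop :=
  forall (a b : J) (u : a ~> b), fmap F u ∘ p a = p b.

Definition is_limit (J C : category) (F : functor J C)
    (L : C) (p : forall j : J, L ~> F j) : Prop :=
  is_cone p /\
  forall (Y : C) (q : forall j : J, Y ~> F j), is_cone q ->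
    exists! h : Y ~> L, forall j, p j ∘ h = q j.

Definition finite_category (J : category) : Prop :=
  finite_set [set: obj J] /\ forall a b : J, finite_set [set: a ~> b].

Definition has_finite_limits (C : category) : Prop :=
  forall J : category, finite_category J -> forall F : functor J C,
    exists (L : C) (p : forall j : J, L ~> F j), is_limit p.

Section Notions.
Variable C : category.

Definition is_terminal (T : C) : Prop :=
  forall Y : C, exists! h : Y ~> T, True.

Definition is_pullback (A B Z P : C) (f : A ~> Z) (g : B ~> Z)
    (p : P ~> A) (q : P ~> B) : Prop :=
  f ∘ p = g ∘ q /\
  forall (Y : C) (u : Y ~> A) (v : Y ~> B), f ∘ u = g ∘ v ->
    exists! h : Y ~> P, p ∘ h = u /\ q ∘ h = v.

Definition is_pushout (X A B P : C) (f : X ~> A) (g : X ~> B)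
    (p : A ~> P) (q : B ~> P) : Prop :=
  p ∘ f = q ∘ g /\
  forall (Y : C) (u : A ~> Y) (v : B ~> Y), u ∘ f = v ∘ g ->
    exists! h : P ~> Y, h ∘ p = u /\ h ∘ q = v.

Definition is_coequalizer (K X Q : C) (u v : K ~> X) (e : X ~> Q) : Prop :=
  e ∘ u = e ∘ v /\
  forall (Y : C) (t : X ~> Y), t ∘ u = t ∘ v -> exists! h : Q ~> Y, h ∘ e = t.

Definition regular_epi (X Q : C) (e : X ~> Q) : Prop :=
  exists (K : C) (u v : K ~> X), is_coequalizer u v e.

Definition is_kernel_pair (X Y K : C) (f : X ~> Y) (u v : K ~> X) : Prop :=
  is_pullback f f u v.

Definition is_regular : Prop :=
  [/\ has_finite_limits C,
      forall (X Y K : C) (f : X ~> Y) (u v : K ~> X), is_kernel_pair f u v ->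
        exists (Q : C) (e : X ~> Q), is_coequalizer u v e
    & forall (A B Z P : C) (f : A ~> Z) (g : B ~> Z) (p : P ~> A) (q : P ~> B),
        is_pullback f g p q -> regular_epi f -> regular_epi q].

Definition global_support (X : C) : Prop :=
  exists (T : C) (t : X ~> T), is_terminal T /\ regular_epi t.

Definition is_product (I : Type) (X : C) (A : I -> C)
    (f : forall i, X ~> A i) : Prop :=
  forall (Y : C) (g : forall i, Y ~> A i),
    exists! h : Y ~> X, forall i, f i ∘ h = g i.

Definition is_binary_product (X A B : C) (f : X ~> A) (g : X ~> B) : Prop :=
  forall (Y : C) (u : Y ~> A) (v : Y ~> B),
    exists! h : Y ~> X, f ∘ h = u /\ g ∘ h = v.

(* Either leg of a binary product diagram: is_binary_product is symmetric in
   its two legs, so it is enough to mention the first one. *)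
Definition product_projection (X A : C) (f : X ~> A) : Prop :=
  exists (A' : C) (f' : X ~> A'), is_binary_product f f'.

Definition has_projection_pushouts (X : C) : Prop :=
  forall (A B : C) (f : X ~> A) (g : X ~> B),
    product_projection f -> product_projection g ->
    exists (P : C) (p : A ~> P) (q : B ~> P), is_pushout f g p q.

Definition finite_strict_refinement (X : C) : Prop :=
  forall (I J : finType) (A : I -> C) (B : J -> C)
    (f : forall i, X ~> A i) (g : forall j, X ~> B j),
    is_product f -> is_product g ->
    exists (D : I -> J -> C)
      (alpha : forall i j, A i ~> D i j) (beta : forall i j, B j ~> D i j),
      [/\ forall i j, alpha i j ∘ f i = beta i j ∘ g j,
          forall i, is_product (fun s : J => alpha i s)
        & forall j, is_product (fun t : I => beta t j)].

Definition morphism_class : Type := forall X Y : C, (X ~> Y) -> Prop.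

Definition is_class_pushout (M : morphism_class) (X A B P : C)
    (f : X ~> A) (g : X ~> B) (p : A ~> P) (q : B ~> P) : Prop :=
  [/\ is_pushout f g p q, M A P p & M B P q].

Definition coextensive (M : morphism_class) (X : C) : Prop :=
  (forall (Y A : C) (m : X ~> Y) (f : X ~> A),
     M X Y m -> product_projection f ->
     exists (P : C) (p : Y ~> P) (q : A ~> P), is_class_pushout M m f p q) /\
  (forall (A1 A2 Y B1 B2 : C)
     (p1 : X ~> A1) (p2 : X ~> A2) (q1 : Y ~> B1) (q2 : Y ~> B2)
     (a1 : A1 ~> B1) (y : X ~> Y) (a2 : A2 ~> B2),
     is_binary_product p1 p2 ->
     M A1 B1 a1 -> M X Y y -> M A2 B2 a2 ->
     a1 ∘ p1 = q1 ∘ y -> a2 ∘ p2 = q2 ∘ y ->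
     (is_binary_product q1 q2 <->
      is_class_pushout M p1 y a1 q1 /\ is_class_pushout M p2 y a2 q2)).

Definition projection_coextensive (X : C) : Prop :=
  coextensive product_projection X.

End Notions.

(* Main.v *)
(** Two facts drive the proof.  Since [X] has global support, product
    projections of any object receiving a morphism from [X] are regular epis, so
    generalized elements of quotients of [X] lift to [X] after passing to a cover.
    - If [X = A1 * A2] maps to [Y = B1 * B2] compatibly by a regular epi [y], the
      element [(p1 x, p2 x')] of [X] shows that any morphism out of [Y] agreeing on
      [X] with one out of [A1] identifies elements having the same [q1]; thus both
      squares are pushouts.  With refinement this yields coextensivity.
    - Conversely, let [D i] be the pushout of [y : X -> Y] along [f i : X -> A i].
      The maps [Y -> D i] are jointly monic: go from [x] to [x'] by changing one
      coordinate at a time; each step preserves [y], by coextensivity applied to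
      [f i] and its complement.  Given joint monicity, the mediating morphisms
      into [Y] are built on a cover and descend. *)
Require Import Defs.
From mathcomp Require Import all_boot.
From mathcomp Require Import boolp classical_sets cardinality.

Set Implicit Arguments.
Unset Strict Implicit.
Unset Printing Implicit Defensive.
Local Open Scope classical_set_scope.
Local Open Scope cat_scope.

(** * Finite index shapes given by boolean preorders *)

Section ThinCategory.
Variables (T : finType) (r : rel T).
Hypotheses (rr : reflexive r) (rt : transitive r).

Definition thin_category : category.
Proof.
refine (@Category T (fun a b => r a b) (fun a => rr a)
  (fun a b c (v : r b c) (u : r a b) => rt u v) _ _ _);
  by move=> *; exact: bool_irrelevance.
Defined.

Lemma thin_finite : finite_category thin_category.
Proof.
split; first exact: (@finite_finset T).
move=> a b; case: (boolP (r a b)) => [rab|/negP nrab].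
  suff -> : [set: @hom thin_category a b] = [set (rab : @hom thin_category a b)].
    exact: finite_set1.
  by apply/seteqP; split=> // u _; exact: bool_irrelevance.
suff -> : [set: @hom thin_category a b] = set0 by exact: finite_set0.
by apply/seteqP; split=> // u _; exact: (nrab u).
Qed.

End ThinCategory.

(** * Finite products and pullbacks from finite limits *)

Section FiniteLimits.
Variables (C : category) (hC : has_finite_limits C).

Lemma finite_products_exist (I : finType) (A : I -> C) :
  exists (P : C) (f : forall i, P ~> A i), is_product f.
Proof.
have er : reflexive (@eq_op I) by exact: eqxx.
have et : transitive (@eq_op I) by move=> y x z /eqP ->.
pose J := thin_category er et.
(* The shape is discrete: an arrow [u] is an equality [a = b], along which the identity is
   transported. *)
pose m (a b : J) (u : a ~> b) : A a ~> A b :=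
  match elimT eqP u in _ = b return A a ~> A b with erefl => idm (A a) end.
have mE (a : J) (u : a ~> a) : m a a u = idm (A a).
  by rewrite /m (eq_irrelevance (elimT eqP u) erefl).
have mM (a b c : J) (v : b ~> c) (u : a ~> b) :
    m a c (v ∘ u) = m b c v ∘ m a b u.
  have eab : a = b := elimT eqP u; have ebc : b = c := elimT eqP v.
  by subst b; subst c; rewrite !mE comp1m.
have [L [p [_ pU]]] := hC (thin_finite er et) (@Functor J C A m (fun a => mE a _) mM).
exists L, p => Y g; apply: pU => a b u /=.
by have eab : a = b := elimT eqP u; subst b; rewrite mE comp1m.
Qed.

Lemma pullbacks_exist (A B Z : C) (f : A ~> Z) (g : B ~> Z) :
  exists (P : C) (p : P ~> A) (q : P ~> B), is_pullback f g p q.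
Proof.
(* The cospan shape: [Some true] and [Some false] are its feet, [None] the common target. *)
pose r : rel (option bool) := fun a b => (a == b) || (b == None).
have rr : reflexive r by move=> a; rewrite /r eqxx.
have rt : transitive r by move=> [[]|] [[]|] [[]|].
pose J := thin_category rr rt.
pose F (a : J) : C :=
  match a with Some true => A | Some false => B | None => Z end.
pose m (a b : J) : (a ~> b) -> (F a ~> F b) :=
  match a, b return r a b -> (F a ~> F b) with
  | Some true, Some true => fun _ => idm A
  | Some false, Some false => fun _ => idm B
  | None, None => fun _ => idm Z
  | Some true, None => fun _ => f
  | Some false, None => fun _ => g
  | Some true, Some false => fun u => match notF u with end
  | Some false, Some true => fun u => match notF u with end
  | None, Some _ => fun u => match notF u with end
  end.
have mE (a : J) : m a a (idm a) = idm (F a) by case: a => [[]|].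
have mM (a b c : J) (v : b ~> c) (u : a ~> b) :
    m a c (v ∘ u) = m b c v ∘ m a b u.
  by case: a b c u v => [[]|] [[]|] [[]|] //= u v; rewrite ?comp1m ?compm1.
have [L [p [pC pU]]] := hC (thin_finite rr rt) (@Functor J C F m mE mM).
exists L, (p (Some true)), (p (Some false)); split.
  by rewrite (pC (Some true) None isT) (pC (Some false) None isT).
move=> Y u v uv.
pose q (j : J) : Y ~> F j :=
  match j with Some true => u | Some false => v | None => f ∘ u end.
have [|h [hq hU]] := pU Y q.
  by case=> [[]|] [[]|] //= w; rewrite ?comp1m.
exists h; split; first by split; [exact: (hq (Some true)) | exact: (hq (Some false))].
move=> h' [h'u h'v]; apply: hU => -[[]|] //=.
by rewrite -(pC (Some true) None isT) /= -compmA h'u.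
Qed.

End FiniteLimits.

(** * Products, pushouts and epimorphisms in an arbitrary category *)

Section Diagrams.
Variable C : category.

Lemma product_ext (I : Type) (X : C) (A : I -> C) (f : forall i, X ~> A i)
    (T : C) (x x' : T ~> X) :
  is_product f -> (forall i, f i ∘ x = f i ∘ x') -> x = x'.
Proof.
move=> fP e; have [h [_ hU]] := fP T (fun i => f i ∘ x').
by rewrite -(hU x e) -(hU x' (fun=> erefl)).
Qed.

Lemma binary_product_ext (X A B T : C) (f : X ~> A) (g : X ~> B)
    (x x' : T ~> X) :
  is_binary_product f g -> f ∘ x = f ∘ x' -> g ∘ x = g ∘ x' -> x = x'.
Proof.
move=> fg ef eg; have [h [_ hU]] := fg T (f ∘ x') (g ∘ x').
by rewrite -(hU x) // -(hU x').
Qed.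

Lemma is_binary_product_sym (X A B : C) (f : X ~> A) (g : X ~> B) :
  is_binary_product f g -> is_binary_product g f.
Proof.
move=> fg Y u v; have [h [[hv hu] hU]] := fg Y v u.
by exists h; split=> // h' [e1 e2]; apply: hU.
Qed.

Lemma product_projectionr (X A B : C) (f : X ~> A) (g : X ~> B) :
  is_binary_product f g -> product_projection g.
Proof. by move=> fg; exists A, f; exact: is_binary_product_sym. Qed.

Definition bool_family (A B : C) (b : bool) : C := if b then A else B.

Definition bool_cone (X A B : C) (f : X ~> A) (g : X ~> B) (b : bool) :
    X ~> bool_family A B b :=
  if b as b return X ~> bool_family A B b then f else g.

Lemma bool_product (X : C) (A : bool -> C) (f : forall b, X ~> A b) :
  is_product f <-> is_binary_product (f true) (f false).
Proof.
split=> fP Y.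
  move=> u v; pose k b : Y ~> A b := if b as b return Y ~> A b then u else v.
  have [h [hk hU]] := fP Y k.
  exists h; split; first by split; [exact: (hk true) | exact: (hk false)].
  by move=> h' [e1 e2]; apply: hU => -[].
move=> k; have [h [[e1 e2] hU]] := fP Y (k true) (k false).
by exists h; split=> [[] //|h' e]; apply: hU.
Qed.

Lemma is_pushout_sym (X A B P : C) (f : X ~> A) (g : X ~> B)
    (p : A ~> P) (q : B ~> P) :
  is_pushout f g p q -> is_pushout g f q p.
Proof.
move=> [e pU]; split=> // Y u v uv; have [h [[h1 h2] hU]] := pU Y v u (esym uv).
by exists h; split=> // h' [e1 e2]; apply: hU.
Qed.

Lemma is_class_pushout_sym (M : morphism_class C) (X A B P : C)
    (f : X ~> A) (g : X ~> B) (p : A ~> P) (q : B ~> P) :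
  is_class_pushout M f g p q -> is_class_pushout M g f q p.
Proof. by case=> /is_pushout_sym. Qed.

Lemma pushout_iso (X A B P P' : C) (f : X ~> A) (g : X ~> B)
    (p : A ~> P) (q : B ~> P) (p' : A ~> P') (q' : B ~> P') :
  is_pushout f g p q -> is_pushout f g p' q' ->
  exists (k : P ~> P') (k' : P' ~> P),
    [/\ k ∘ k' = idm P', k' ∘ k = idm P & k ∘ q = q'].
Proof.
move=> [e pU] [e' pU'].
have [k [[k1 k2] _]] := pU _ _ _ e'; have [k' [[k1' k2'] _]] := pU' _ _ _ e.
exists k, k'; split=> //.
  have [i [_ iU]] := pU' _ _ _ e'; rewrite -(iU (idm P')); last by rewrite !comp1m.
  by symmetry; apply: iU; rewrite -!compmA k1' k2'.
have [i [_ iU]] := pU _ _ _ e; rewrite -(iU (idm P)); last by rewrite !comp1m.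
by symmetry; apply: iU; rewrite -!compmA k1 k2.
Qed.

Lemma binary_product_iso (X A B A' B' : C) (f : X ~> A) (g : X ~> B)
    (k : A ~> A') (k' : A' ~> A) (l : B ~> B') (l' : B' ~> B) :
  k ∘ k' = idm A' -> k' ∘ k = idm A -> l ∘ l' = idm B' -> l' ∘ l = idm B ->
  is_binary_product f g -> is_binary_product (k ∘ f) (l ∘ g).
Proof.
move=> kk' k'k ll' l'l fg Y u v; have [h [[e1 e2] hU]] := fg Y (k' ∘ u) (l' ∘ v).
exists h; split.
  by rewrite -!compmA e1 e2 !compmA kk' ll' !comp1m.
move=> h' [h'u h'v]; apply: hU.
by rewrite -h'u -h'v !compmA k'k l'l !comp1m.
Qed.

Definition mono (X Y : C) (m : X ~> Y) : Prop :=
  forall (T : C) (a b : T ~> X), m ∘ a = m ∘ b -> a = b.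

(** Strong epis compose and cancel in any category, unlike regular epis; [strong_epi_regular]
    carries both properties over to regular epis. *)
Definition strong_epi (X Y : C) (e : X ~> Y) : Prop :=
  forall (A B : C) (m : A ~> B) (a : X ~> A) (b : Y ~> B),
    mono m -> m ∘ a = b ∘ e -> exists w : Y ~> A, w ∘ e = a /\ m ∘ w = b.

Lemma regular_epi_epi (X Y T : C) (e : X ~> Y) (a b : Y ~> T) :
  regular_epi e -> a ∘ e = b ∘ e -> a = b.
Proof.
move=> [K [u [v [euv eU]]]] ab.
have [|h [_ hU]] := eU T (b ∘ e); first by rewrite -!compmA euv.
by rewrite -(hU a ab) -(hU b erefl).
Qed.

Lemma regular_epi_factor (X Y Z : C) (e : X ~> Y) (t : X ~> Z) :
  regular_epi e ->
  (forall (T : C) (a b : T ~> X), e ∘ a = e ∘ b -> t ∘ a = t ∘ b) ->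
  exists w : Y ~> Z, w ∘ e = t.
Proof.
move=> [K [u [v [euv eU]]]] et.
by have [h [he _]] := eU Z t (et _ _ _ euv); exists h.
Qed.

Lemma regular_epi_strong (X Y : C) (e : X ~> Y) : regular_epi e -> strong_epi e.
Proof.
move=> re A B m a b mm mab.
have [|w we] := regular_epi_factor (t := a) re.
  by move=> T c d ecd; apply: mm; rewrite !compmA mab -!compmA ecd.
exists w; split=> //; apply: (regular_epi_epi re).
by rewrite -compmA we.
Qed.

Lemma strong_epi_comp (X Y Z : C) (f : X ~> Y) (g : Y ~> Z) :
  strong_epi f -> strong_epi g -> strong_epi (g ∘ f).
Proof.
move=> sf sg A B m a b mm; rewrite compmA => mab.
have [w [wf mw]] := sf _ _ _ _ _ mm mab.
have [z [zg mz]] := sg _ _ _ _ _ mm mw.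
by exists z; rewrite compmA zg.
Qed.

Lemma strong_epi_cancel (X Y Z : C) (f : X ~> Y) (g : Y ~> Z) :
  strong_epi (g ∘ f) -> strong_epi g.
Proof.
move=> sgf A B m a b mm mab.
have [|w [_ mw]] := sgf _ _ m (a ∘ f) b mm; first by rewrite !compmA mab.
by exists w; split=> //; apply: mm; rewrite compmA mw.
Qed.

End Diagrams.

(** * Covers in a regular category *)

Section Regular.
Variables (C : category) (hC : is_regular C).

Lemma cover_lift (X Y T : C) (e : X ~> Y) (u : T ~> Y) : regular_epi e ->
  exists (T' : C) (c : T' ~> T) (v : T' ~> X), regular_epi c /\ e ∘ v = u ∘ c.
Proof.
case: hC => lim _ stab re.
have [P [v [c pb]]] := pullbacks_exist lim e u.
by exists P, c, v; split; [exact: stab pb re | case: pb].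
Qed.

(** Factor [e] as [m ∘ q] with [q] the coequalizer of its kernel pair. Then [m] is monic, and
    strength of [e] gives it a section. *)
Lemma strong_epi_regular (X Y : C) (e : X ~> Y) : strong_epi e -> regular_epi e.
Proof.
case: (hC) => lim coeq _ se.
have [K [u [v [euv kU]]]] := pullbacks_exist lim e e.
have [Q [q qC]] := coeq _ _ _ _ _ _ (conj euv kU).
have rq : regular_epi q by exists K, u, v.
have [quv qU] := qC; have [m [mq _]] := qU _ _ euv.
have mm : mono m.
  move=> T a b mab.
  have [T1 [c [x [rc xa]]]] := cover_lift a rq.
  have [T2 [d [x' [rd xb]]]] := cover_lift (b ∘ c) rq.
  apply: (regular_epi_epi rc); apply: (regular_epi_epi rd).
  rewrite -xa -xb -compmA.
  (* The lifts of [a] and [b] along [q] have the same image under [e], so they form an element of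
     the kernel pair, which [q] coequalizes. *)
  have [|k [[<- <-] _]] := kU _ (x ∘ d) x'.
    by rewrite -mq -!compmA xb (compmA q x) xa !compmA mab.
  by rewrite !compmA quv.
have [|w [we mw]] := se _ _ m q (idm Y) mm; first by rewrite comp1m.
exists K, u, v; split=> // Z t tuv.
have [h [hq hU]] := qU _ _ tuv.
exists (h ∘ w); split; first by rewrite -compmA we.
by move=> h' h'e; rewrite (hU (h' ∘ m)) -?compmA ?mw ?compm1 // mq.
Qed.

Lemma regular_epi_comp (X Y Z : C) (f : X ~> Y) (g : Y ~> Z) :
  regular_epi f -> regular_epi g -> regular_epi (g ∘ f).
Proof.
move=> /regular_epi_strong sf /regular_epi_strong sg.
exact/strong_epi_regular/strong_epi_comp.
Qed.

(** The complement is the product of all factors other than [A a]. The last clause lets it be used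
    without mentioning the subtype. *)
Lemma product_complement (I : finType) (X : C) (A : I -> C)
    (f : forall i, X ~> A i) (a : I) : is_product f ->
  exists (A' : C) (f' : X ~> A'), is_binary_product (f a) f' /\
    forall (T : C) (x x' : T ~> X),
      (forall i, i != a -> f i ∘ x = f i ∘ x') -> f' ∘ x = f' ∘ x'.
Proof.
move=> fP; case: hC => lim _ _.
have [P [p pP]] :=
  finite_products_exist lim (fun i : {i | i != a} => A (val i)).
have [f' [pf' _]] := pP X (fun i => f (val i)).
exists P, f'; split; last first.
  move=> T x x' e; apply: (product_ext pP) => i.
  by rewrite !compmA pf'; exact: e (valP i).
move=> Y u v.
(* The type [Y ~> A i] depends on [i], so the case [a = i] needs a cast of [u]; both cases are
   specified first and the family is then chosen. *)
have g_ex i : exists g : Y ~> A i,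
    (forall e : a = i, g = ecast i (Y ~> A i) e u) /\
    forall h : i != a, g = p (Sub i h) ∘ v.
  have [h|/negP/negPn/eqP ->] := pselect (i != a); last first.
    exists u; split=> [e|h]; first by rewrite (eq_irrelevance e erefl).
    by have := h; rewrite eqxx.
  exists (p (Sub i h) ∘ v); split=> [e|h'].
    by case/eqP: (h).
  by rewrite (bool_irrelevance h h').
have [g gP] : {g : forall i, Y ~> A i | forall i,
    (forall e : a = i, g i = ecast i (Y ~> A i) e u) /\
    forall h : i != a, g i = p (Sub i h) ∘ v}.
  exists (fun i => projT1 (cid (g_ex i))) => i.
  exact: projT2 (cid (g_ex i)).
have [h [hg hU]] := fP Y g.
have gN (i : {i | i != a}) : g (val i) = p i ∘ v.
  by case: i => i ia; exact: (gP i).2.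
exists h; split.
  split; first by rewrite hg (gP a).1.
  by apply: (product_ext pP) => i; rewrite compmA pf' hg gN.
move=> h' [hu hv]; apply: hU => i; case: (eqVneq i a) => [->|ia].
  by rewrite hu (gP a).1.
rewrite ((gP i).2 ia) -hv compmA.
by rewrite pf'.
Qed.

Lemma product_proj (I : finType) (X : C) (A : I -> C)
    (f : forall i, X ~> A i) (a : I) : is_product f -> product_projection (f a).
Proof. by move=> /product_complement-/(_ a) [A' [f' [fP _]]]; exists A', f'. Qed.

(** * Global support, and from refinement to coextensivity *)

Section GlobalSupport.
Variables (X : C) (hX : global_support X).

(** Over a cover [c] of [P] there is an element of [X], hence via [q ∘ y] one of the complement [Q].
    Pairing it with [c] factors [c] through [p], and strong epis cancel. *)
Lemma projection_regular_epi (Y P : C) (y : X ~> Y) (p : Y ~> P) :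
  product_projection p -> regular_epi p.
Proof.
move=> [Q [q pq]]; have [T [t [tT rt]]] := hX.
have [s _] := tT P.
have [K [c [x [rc _]]]] := cover_lift s rt.
have [h [[ph _] _]] := pq K c (q ∘ (y ∘ x)).
apply: strong_epi_regular; apply: (@strong_epi_cancel _ _ _ _ h).
by rewrite ph; exact: regular_epi_strong.
Qed.

Lemma projection_epi (A : C) (f : X ~> A) :
  product_projection f -> regular_epi f.
Proof. exact: (@projection_regular_epi X A (idm X)). Qed.

Lemma product_square_pushout (A1 A2 Y B1 B2 : C)
    (p1 : X ~> A1) (p2 : X ~> A2) (q1 : Y ~> B1) (q2 : Y ~> B2)
    (a1 : A1 ~> B1) (y : X ~> Y) (a2 : A2 ~> B2) :
  is_binary_product p1 p2 -> is_binary_product q1 q2 -> regular_epi y ->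
  a1 ∘ p1 = q1 ∘ y -> a2 ∘ p2 = q2 ∘ y -> is_pushout p1 y a1 q1.
Proof.
move=> pP qP ry e1 e2; split=> // Z u v uv.
have rq1 : regular_epi q1 by apply: (projection_regular_epi y); exists B2, q2.
have rp1 : regular_epi p1 by apply: projection_epi; exists A2, p2.
have [T t t' q1t|w wq1] := regular_epi_factor (t := v) rq1.
  have [T1 [c [x [rc xt]]]] := cover_lift t ry.
  have [T2 [d [x' [rd xt']]]] := cover_lift (t' ∘ c) ry.
  apply: (regular_epi_epi rc); apply: (regular_epi_epi rd).
  have [z [[z1 z2] _]] := pP _ (p1 ∘ (x ∘ d)) (p2 ∘ x').
  (* The hybrid [z] lies over [t']: its first coordinate is that of [x], and [q1] does not separate
     [t] from [t']; its second is that of [x']. *)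
  have yz : y ∘ z = t' ∘ c ∘ d.
    apply: (binary_product_ext qP).
      rewrite compmA -e1 -compmA z1 compmA e1 -compmA (compmA y) xt.
      by rewrite !compmA q1t.
    by rewrite compmA -e2 -compmA z2 compmA e2 -compmA xt'.
  have : v ∘ (y ∘ z) = v ∘ (y ∘ (x ∘ d)) by rewrite !(compmA v) -uv -!compmA z1.
  by rewrite yz (compmA y) xt !compmA.
exists w; split.
  split=> //; apply: (regular_epi_epi rp1).
  by rewrite -compmA e1 compmA wq1.
by move=> w' [_ w'q1]; apply: (regular_epi_epi rq1); rewrite w'q1.
Qed.

Lemma binary_refinement (A1 A2 B1 B2 : C)
    (f1 : X ~> A1) (f2 : X ~> A2) (g1 : X ~> B1) (g2 : X ~> B2) :
  finite_strict_refinement X -> is_binary_product f1 f2 ->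
  is_binary_product g1 g2 ->
  exists (D1 D2 : C) (a1 : A1 ~> D1) (a2 : A2 ~> D2) (b1 : B1 ~> D1) (b2 : B1 ~> D2),
    [/\ is_class_pushout (@product_projection C) f1 g1 a1 b1,
        is_class_pushout (@product_projection C) f2 g1 a2 b2
      & is_binary_product b1 b2].
Proof.
move=> hF fP gP.
have [D [al [be [sq aP bP]]]] :=
  hF _ _ _ _ _ _ ((bool_product (bool_cone f1 f2)).2 fP)
                 ((bool_product (bool_cone g1 g2)).2 gP).
have ry : regular_epi g1 by apply: projection_epi; exists B2, g2.
(* Only the column of the refinement grid under [B1] is needed. *)
have b12 := (bool_product _).1 (bP true).
have b21 := is_binary_product_sym b12.
exists (D true true), (D false true), (al true true), (al false true),
  (be true true), (be false true).
have e1 := sq true true; have e2 := sq false true.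
split=> //; split.
- exact: (product_square_pushout fP b12 ry e1 e2).
- exact: (product_proj true (aP true)).
- exact: (product_proj true (bP true)).
- exact: (product_square_pushout (is_binary_product_sym fP) b21 ry e2 e1).
- exact: (product_proj true (aP false)).
- exact: (product_proj false (bP true)).
Qed.

Lemma refinement_coextensive :
  finite_strict_refinement X -> projection_coextensive X.
Proof.
move=> hF; split.
  move=> Y A y f [Y' [y' yP]] [A' [f' fP]].
  have [D [_ [a [_ [b [_ [po _ _]]]]]]] := binary_refinement hF fP yP.
  by exists D, b, a; exact: is_class_pushout_sym.
move=> A1 A2 Y B1 B2 p1 p2 q1 q2 a1 y a2 pP ma1 [Y' [y' yP]] ma2 e1 e2; split.
  move=> qP; have ry : regular_epi y by apply: projection_epi; exists Y', y'.
  have qP' := is_binary_product_sym qP.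
  split; split=> //.
  - exact: product_square_pushout pP qP ry e1 e2.
  - by exists B2, q2.
  - exact: product_square_pushout (is_binary_product_sym pP) qP' ry e2 e1.
  - by exists B1, q1.
move=> [[po1 _ _] [po2 _ _]].
(* Refinement gives pushouts whose bottom row is a product; uniqueness of pushouts transports this
   to the given row. *)
have [D1 [D2 [c1 [c2 [b1 [b2 [[po1' _ _] [po2' _ _] bP]]]]]]] :=
  binary_refinement hF pP yP.
have [k [k' [kk' k'k <-]]] := pushout_iso po1' po1.
have [l [l' [ll' l'l <-]]] := pushout_iso po2' po2.
exact: (binary_product_iso kk' k'k ll' l'l bP).
Qed.

(** * Pushouts of a product diagram, and from coextensivity to refinement *)

Section Coextensive.
Hypothesis hE : projection_coextensive X.
Variables (I : finType) (A : I -> C) (f : forall i, X ~> A i).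
Hypothesis fP : is_product f.
Variables (Y : C) (y : X ~> Y).
Hypothesis yM : product_projection y.
Variables (D : I -> C) (al : forall i, A i ~> D i) (be : forall i, Y ~> D i).
Hypothesis po : forall i,
  is_class_pushout (@product_projection C) (f i) y (al i) (be i).

Lemma pushout_square i : al i ∘ f i = be i ∘ y.
Proof. by case: (po i) => -[]. Qed.

(** Coextensivity makes [be a] and the pushout [p] of the complement of [f a] a product diagram;
    [p ∘ y] factors through that complement, where [z] and [z'] agree. *)
Lemma single_coordinate_change (a : I) (T : C) (z z' : T ~> X) :
  (forall i, i != a -> f i ∘ z = f i ∘ z') ->
  be a ∘ (y ∘ z) = be a ∘ (y ∘ z') -> y ∘ z = y ∘ z'.
Proof.
move=> zz' bez; have [hE1 hE2] := hE.
have [A' [f' [ff' f'E]]] := product_complement a fP.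
have f'M : product_projection f' by exact: product_projectionr ff'.
have [P [p [q po']]] := hE1 _ _ _ _ yM f'M.
have po'' := is_class_pushout_sym po'.
have [[e _] qM pM] := po''; have [_ aM _] := po a.
have [_ toP] := hE2 _ _ _ _ _ _ _ _ _ _ _ _ ff' aM yM qM (pushout_square a) e.
apply: (binary_product_ext (toP (conj (po a) po''))) => //.
by rewrite !compmA -e -!compmA (f'E _ _ _ zz').
Qed.

Lemma pushout_legs_ext (T : C) (t t' : T ~> Y) :
  (forall i, be i ∘ t = be i ∘ t') -> t = t'.
Proof.
move=> tt'; have ry := projection_epi yM.
have [T1 [c [x0 [rc xt]]]] := cover_lift t ry.
have [T2 [d [x' [rd xt']]]] := cover_lift (t' ∘ c) ry.
apply: (regular_epi_epi rc); apply: (regular_epi_epi rd).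
have {}xt : y ∘ (x0 ∘ d) = t ∘ c ∘ d by rewrite compmA xt.
move: (x0 ∘ d) xt => x xt; rewrite -xt -xt'.
have bx i : be i ∘ (y ∘ x) = be i ∘ (y ∘ x').
  by rewrite xt xt' !compmA tt'.
(* Walk from [x] to [x']: the hybrid takes its coordinates in [s] from [x'], and [s] grows to all of
   [I]. *)
have hybrid (s : seq I) : exists z : T2 ~> X,
    (forall i, f i ∘ z = f i ∘ (if i \in s then x' else x)) /\ y ∘ z = y ∘ x.
  elim: s => [|a s [z [zE yz]]]; first by exists x.
  have [w [wE _]] := fP (fun i => f i ∘ (if i \in a :: s then x' else x)).
  exists w; split=> //; rewrite -yz; apply: (@single_coordinate_change a).
    by move=> i ia; rewrite wE zE inE (negPf ia).
  by rewrite yz bx !compmA -pushout_square -!compmA wE mem_head.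
have [z [zE <-]] := hybrid (enum I).
congr (_ ∘ _); apply: (product_ext fP) => i.
by rewrite zE mem_enum.
Qed.

Lemma pushout_legs_product : is_product be.
Proof.
move=> T u.
suff [h hu] : exists h : T ~> Y, forall i, be i ∘ h = u i.
  exists h; split=> // h' h'u; apply: pushout_legs_ext => i.
  by rewrite hu h'u.
(* Prescribe the components one at a time, refining the cover at each step. Global support supplies
   the initial element of [X]. *)
have lift (s : seq I) : exists (T' : C) (c : T' ~> T) (x : T' ~> X),
    regular_epi c /\ forall i, i \in s -> be i ∘ (y ∘ x) = u i ∘ c.
  elim: s => [|a s [T1 [c [x [rc xE]]]]].
    have [K [k [kT rk]]] := hX; have [s _] := kT T.
    by have [T' [c [x [rc _]]]] := cover_lift s rk; exists T', c, x.
  have rbe : regular_epi (be a).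
    by apply: (projection_regular_epi y); case: (po a).
  have [T2 [d [x' [rd x'E]]]] :=
    cover_lift (u a ∘ c) (regular_epi_comp (projection_epi yM) rbe).
  (* Since [be i ∘ y] factors through [f i], replacing coordinate [a] leaves the components already
     fixed at other indices intact. *)
  have [z [zE _]] := fP (fun i => f i ∘ (if i == a then x' else x ∘ d)).
  exists T2, (c ∘ d), z; split; first exact: regular_epi_comp.
  move=> i; rewrite inE compmA -pushout_square -compmA zE.
  case: eqVneq => [->|_] /= is_.
    by rewrite compmA pushout_square x'E compmA.
  by rewrite [in RHS]compmA -(xE i is_) compmA pushout_square !compmA.
have [T' [c [x [rc xE]]]] := lift (enum I).
(* Joint monicity of the legs makes [y ∘ x] descend along the cover. *)
have [S a b cab|h hc] := regular_epi_factor (t := y ∘ x) rc.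
  apply: pushout_legs_ext => i.
  by rewrite !(compmA (be i) (y ∘ x)) xE ?mem_enum // -!compmA cab.
exists h => i; apply: (regular_epi_epi rc).
by rewrite -compmA hc xE ?mem_enum.
Qed.

End Coextensive.

Lemma coextensive_refinement :
  projection_coextensive X -> finite_strict_refinement X.
Proof.
move=> hE I J A B f g fP gP.
(* The grid consists of the pushouts of [f i] and [g j]. Each is packed with its legs so that one
   choice yields all three; rows take [y := f i], columns [y := g j]. *)
have ex (i : I) (j : J) : exists D : {P : C & ((A i ~> P) * (B j ~> P))%type},
    is_class_pushout (@product_projection C) (f i) (g j)
      (projT2 D).1 (projT2 D).2.
  have [P [p [q po]]] := hE.1 _ _ _ _ (product_proj j gP) (product_proj i fP).
  by exists (existT _ P (q, p)); exact: is_class_pushout_sym.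
pose D i j := projT1 (cid (ex i j)).
have po i j : is_class_pushout (@product_projection C) (f i) (g j)
    (projT2 (D i j)).1 (projT2 (D i j)).2 := projT2 (cid (ex i j)).
exists (fun i j => projT1 (D i j)), (fun i j => (projT2 (D i j)).1),
  (fun i j => (projT2 (D i j)).2); split.
- by move=> i j; case: (po i j) => -[].
- move=> i; apply: (pushout_legs_product hE gP (product_proj i fP)) => j.
  exact: is_class_pushout_sym (po i j).
- move=> j; exact: (pushout_legs_product hE fP (product_proj j gP) (po^~ j)).
Qed.

End GlobalSupport.
End Regular.

Theorem theorem4p1 (C : category) (hC : is_regular C) (X : obj C)
    (hX : global_support X) (hpo : has_projection_pushouts X) :
  finite_strict_refinement X <-> projection_coextensive X.
Proof.
split; [exact: refinement_coextensive | exact: coextensive_refinement].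
Qed.
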